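(* Let $S$ be a solution concept (for games with a fixed player set $\{1,\dots,n\}$, $n\ge 2$) that permits bracketing and satisfies distribution-monotonicity and anonymity. Then $S$ is a refinement of some statistic response equilibrium (SRE).
   Context: Games. Fix an integer $n\ge 2$ and the player set $\{1,\dots,n\}$. All actions belong to a fixed nonempty universal set $\mathcal{A}$ that is closed under pairing, $\mathcal{A}\times\mathcal{A}\subseteq\mathcal{A}$ (hence infinite). A game $G=(A,u)$ consists of $A=\prod_i A_i$ with each $A_i\subset\mathcal{A}$ finite and nonempty, and $u\colon A\to\mathbb{R}^n$. A mixed strategy profile is $p=(p_1,\dots,p_n)\in\prod_i\Delta A_i$; it is identified with the product distribution on $A$, and $p_{-i}$ is its marginal on $A_{-i}=\prod_{j\ne i}A_j$. For $a_i\in A_i$, $u_i(a_i,p_{-i})$ denotes the lottery (distribution of payoffs) of player $i$ when playing $a_i$ while the others play $p_{-i}$. Solution concepts. A solution concept $S$ assigns to each game $G=(A,u)$ a nonempty set $S(G)\subseteq\prod_i\Delta A_i$. $S$ is a refinement of $S'$ if $S(G)\subseteq S'(G)$ for all games $G$. Bracketing. For $G=(A,u)$, $H=(B,v)$ the composite game $G\otimes H=(C,w)$ has $C_i=A_i\times B_i$ and $w_i((a_1,b_1),\dots,(a_n,b_n))=u_i(a)+v_i(b)$. For profiles $p,q$ of $G,H$, $[p\times q]_i(a_i,b_i)=p_i(a_i)q_i(b_i)$. $S$ permits bracketing if for all games $G,H$: $p\in S(G)$ and $q\in S(H)$ imply $p\times q\in S(G\otimes H)$. Stochastic dominance. For lotteries,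 $X\ge_{\mathrm{FOSD}}Y$ means $\Pr[X>t]\ge\Pr[Y>t]$ for all $t\in\mathbb{R}$; $X>_{\mathrm{FOSD}}Y$ means in addition that the distributions of $X$ and $Y$ differ. Distribution-monotonicity: for every game $G=(A,u)$, $p\in S(G)$, player $i$, $a_i,b_i\in A_i$: $u_i(a_i,p_{-i})>_{\mathrm{FOSD}}u_i(b_i,p_{-i})$ implies $p_i(a_i)\ge p_i(b_i)$. Anonymity. For a permutation $\pi$ of $\{1,\dots,n\}$ and $G=(A,u)$, the permuted game $G_\pi=(B,v)$ has $B_i=A_{\pi(i)}$ and $v_i(a_{\pi(1)},\dots,a_{\pi(n)})=u_{\pi(i)}(a_1,\dots,a_n)$; the permuted profile is $(p_\pi)_i=p_{\pi(i)}$. $S$ satisfies anonymity if $p\in S(G)$ implies $p_\pi\in S(G_\pi)$ for all $G$, $\pi$. Statistics. A lottery is a finitely supported probability distribution on $\mathbb{R}$; $X+Y$ denotes the lottery of the sum of independent draws (convolution). A monotone additive statistic is a map $\Phi$ from lotteries to $\mathbb{R}$ with $\Phi[c]=c$ for every deterministic lottery $c$, $\Phi[X+Y]=\Phi[X]+\Phi[Y]$ for all lotteries $X,Y$ (convolution), and $\Phi[Z]\le\Phi[W]$ whenever $Z\le_{\mathrm{FOSD}}W$. SRE. Given a monotone additive statistic $\Phi$, $p$ is a $\mathrm{Nash}_\Phi$ equilibrium of $G=(A,u)$ if $\operatorname{supp}p_i\subseteq\arg\max_{a_i\in A_i}\Phi[u_i(a_i,p_{-i})]$ for all $i$. Given also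 $\lambda\ge0$, $p$ is an $\mathrm{LQRE}_{\lambda\Phi}$ equilibrium of $G$ if $p_i(a_i)\propto\exp(\lambda\Phi[u_i(a_i,p_{-i})])$ for all $i$ and $a_i\in A_i$. An SRE is a solution concept (so nonempty for every game) that, for some $\Phi$, assigns to every game the set of all its $\mathrm{Nash}_\Phi$ equilibria, or that, for some $\Phi$ and $\lambda\ge 0$, assigns to every game the set of all its $\mathrm{LQRE}_{\lambda\Phi}$ equilibria. *)

(* Defs.v *)
From mathcomp Require Import all_boot all_order all_algebra all_fingroup.
From mathcomp Require Import finmap.
From mathcomp Require Import boolp classical_sets cardinality reals.
From mathcomp Require Import sequences exp.

Set Implicit Arguments.
Unset Strict Implicit.
Unset Printing Implicit Defensive.

Import Order.TTheory GRing.Theory Num.Theory.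
Local Open Scope ring_scope.

Section Distributions.
Context {R : realType}.

Definition is_dist (T : finType) (mu : T -> R) : Prop :=
  (forall t, 0 <= mu t) /\ \sum_t mu t = 1.

Record lottery := Lottery {
  pmf :> {fsfun R -> R with 0};
  pmf_ge0 : forall x, 0 <= pmf x;
  pmf_sum1 : \sum_(x <- finsupp pmf) pmf x = 1
}.

Lemma pmf_inj : injective pmf.
Proof.
move=> [f f0 f1] [g g0 g1] /= fg; case: _ / fg g0 g1 => g0 g1.
by congr Lottery; exact: Prop_irrelevance.
Qed.

Definition law_fun (T : finType) (mu : T -> R) (f : T -> R) :
    {fsfun R -> R with 0} :=
  [fsfun x in [fset f t | t in T]%fset => \sum_(t | f t == x) mu t].

Lemma law_funE (T : finType) (mu : T -> R) (f : T -> R) x :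
  law_fun mu f x = \sum_(t | f t == x) mu t.
Proof.
rewrite fsfun_fun; case: ifPn => // xf; rewrite big1// => t /eqP ftx.
by case/negP: xf; apply/imfsetP; exists t.
Qed.

Lemma law_fun_ge0 (T : finType) (mu : T -> R) (f : T -> R) :
  is_dist mu -> forall x, 0 <= law_fun mu f x.
Proof. by move=> [mu0 _] x; rewrite law_funE sumr_ge0. Qed.

Lemma law_fun_sum1 (T : finType) (mu : T -> R) (f : T -> R) :
  is_dist mu -> \sum_(x <- finsupp (law_fun mu f)) law_fun mu f x = 1.
Proof.
move=> [_ mu1]; set S := [fset f t | t in T]%fset.
rewrite (@big_fset_incl _ _ _ _ _ S); first last.
- by move=> x _; exact: fsfun_dflt.
- apply/fsubsetP => x; rewrite mem_finsupp fsfun_fun.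
  by case: ifPn; rewrite ?eqxx.
under eq_bigr do rewrite law_funE big_mkcond.
rewrite exchange_big /= -[RHS]mu1; apply: eq_bigr => t _.
have tS : f t \in S by apply/imfsetP; exists t.
rewrite (bigD1_seq _ tS (fset_uniq _)) /= eqxx big1 ?addr0// => x.
by rewrite eq_sym => /negPf ->.
Qed.

(* The distribution of [f] when its argument has distribution [mu]. *)
Definition law (T : finType) (mu : T -> R) (f : T -> R) (mu_dist : is_dist mu) :
    lottery :=
  Lottery (law_fun_ge0 f mu_dist) (law_fun_sum1 f mu_dist).

Lemma dist_unit : is_dist (fun _ : unit => 1 : R).
Proof. by split=> //; rewrite big_const card_unit /= addr0. Qed.

Definition sure (c : R) : lottery := law (fun=> c) dist_unit.

Lemma dist_prod (T T' : finType) (mu : T -> R) (nu : T' -> R) :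
  is_dist mu -> is_dist nu -> is_dist (fun t : T * T' => mu t.1 * nu t.2).
Proof.
move=> [mu0 mu1] [nu0 nu1]; split=> [t|]; first exact: mulr_ge0.
rewrite -(pair_bigA _ (fun t t' => mu t * nu t')) /=.
by under eq_bigr do rewrite -big_distrr /= nu1 mulr1.
Qed.

Lemma dist_lottery (X : lottery) : is_dist (fun x : finsupp X => X (val x)).
Proof.
split=> [x|]; first exact: pmf_ge0.
by rewrite -(big_seq_fsetE _ _ xpredT) /= pmf_sum1.
Qed.

Definition convolution (X Y : lottery) : lottery :=
  law (fun t : finsupp X * finsupp Y => val t.1 + val t.2)
      (dist_prod (dist_lottery X) (dist_lottery Y)).

Definition tail (X : lottery) (t : R) : R :=
  \sum_(x <- finsupp X | t < x) X x.

Definition fosd_ge (X Y : lottery) : Prop := forall t, tail Y t <= tail X t.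

Definition fosd_gt (X Y : lottery) : Prop := fosd_ge X Y /\ X <> Y.

Record is_mon_add_stat (Phi : lottery -> R) : Prop := {
  stat_sure : forall c, Phi (sure c) = c;
  stat_add : forall X Y, Phi (convolution X Y) = Phi X + Phi Y;
  stat_mono : forall Z W, fosd_ge W Z -> Phi Z <= Phi W
}.

Lemma sum_dffun_prod (n : nat) (T : 'I_n -> finType)
    (P : forall i, T i -> R) :
  \sum_(b : {dffun forall i, T i}) \prod_i P i (b i) = \prod_i \sum_x P i x.
Proof.
rewrite (reindex (@dffun_of_fprod _ T)) /=; last exact/onW_bij/dffun_of_fprod_bij.
pose P' i := [ffun x : T i => P i x].
transitivity (\sum_(t : fprod T) \prod_(i in 'I_n) P' i (t i)).
  by apply: eq_bigr => t _; apply: eq_bigr => i _; rewrite !ffunE.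
rewrite (@big_fprod _ _ 1 _ +%R) -(bigA_distr_big_dep (tagged_with T)
  (fun i (x : {i : 'I_n & T i}) => untag 0 (P' i) x)).
apply: eq_bigr => i _; rewrite -(big_tag (fun i x => P' i x) i).
by apply: eq_bigr => x _; rewrite ffunE.
Qed.

End Distributions.
Arguments lottery : clear implicits.

(* The universal action set: in set theory an infinite set containing its own
   square, here an infinite type with an injective pairing operation. *)
Record actionUniverse := ActionUniverse {
  action :> choiceType;
  act_pair : action * action -> action;
  act_pair_inj : injective act_pair;
  act_infinite : infinite_set [set: action]
}.

Section Pairing.
Context {U : actionUniverse}.
Implicit Types A B : {fset U}.

Definition pairs A B : {fset U} := [fset act_pair (a, b) | a in A, b in B]%fset.

Lemma mem_pairs A B (a : A) (b : B) : act_pair (val a, val b) \in pairs A B.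
Proof. by apply: (in_imfset2 _ (fun a b => act_pair (a, b))); exact: valP. Qed.

Definition mkpair A B (z : A * B) : pairs A B := [` mem_pairs z.1 z.2]%fset.

Lemma unpair_exists A B (c : pairs A B) : exists z : A * B, mkpair z == c.
Proof.
case/imfset2P: (valP c) => a aA [b bB e].
by exists ([` aA], [` bB])%fset; apply/eqP/val_inj; rewrite /= e.
Qed.

Definition unpair A B (c : pairs A B) : A * B := xchoose (unpair_exists c).

Lemma unpairK A B : cancel (@unpair A B) (@mkpair A B).
Proof. by move=> c; apply/eqP/(xchooseP (unpair_exists c)). Qed.

Lemma mkpair_inj A B : injective (@mkpair A B).
Proof.
move=> [a b] [a' b'] e; have /act_pair_inj[] := congr1 val e.
by move=> /val_inj-> /val_inj->.
Qed.

Lemma mkpairK A B : cancel (@mkpair A B) (@unpair A B).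
Proof. by move=> z; apply: mkpair_inj; rewrite unpairK. Qed.

Lemma pairs_neq0 A B : A != fset0 -> B != fset0 -> pairs A B != fset0.
Proof.
move=> /fset0Pn[a aA] /fset0Pn[b bB]; apply/fset0Pn.
by exists (act_pair (a, b)); exact: (mem_pairs [` aA]%fset [` bB]%fset).
Qed.

End Pairing.

Section Games.
Context {n : nat} {R : realType} {U : actionUniverse}.

Record game := Game {
  acts : 'I_n -> {fset U};
  acts_neq0 : forall i, acts i != fset0;
  payoff : {dffun forall i : 'I_n, acts i} -> 'I_n -> R
}.

Record profile (G : game) := Profile {
  mix :> forall i, acts G i -> R;
  mix_dist : forall i, is_dist (@mix i)
}.
#[global] Arguments mix {G} p i a : rename.

Lemma profile_eqP (G : game) (p q : profile G) :
  (forall i a, p i a = q i a) -> p = q.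
Proof.
case: p q => [p p1] [q q1] /= pq.
have e : p = q by apply: functional_extensionality_dep => i; exact/funext/pq.
by case: _ / e q1 => q1; congr Profile; exact: Prop_irrelevance.
Qed.

(* The product of the point mass at [a] in coordinate [i] and of p_{-i}. *)
Definition deviation (G : game) (p : profile G) (i : 'I_n) (a : acts G i)
    (b : {dffun forall j : 'I_n, acts G j}) : R :=
  if b i == a then \prod_(j | j != i) p j (b j) else 0.

Lemma deviation_dist (G : game) (p : profile G) (i : 'I_n) (a : acts G i) :
  is_dist (deviation p a).
Proof.
split=> [b|].
  rewrite /deviation; case: ifP => // _.
  by apply: prodr_ge0 => j _; case: (mix_dist p j).
pose P j (x : acts G j) : R := if j == i then
  (Tagged (fun j => acts G j : Type) x == Tagged (fun j => acts G j : Type) a)%:R else p j x.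
transitivity (\sum_(b : {dffun forall j : 'I_n, acts G j}) \prod_j P j (b j)).
  apply: eq_bigr => b _; rewrite (bigD1 i) //= {1}/P eqxx eq_Tagged /= /deviation.
  case: eqP => _; rewrite ?mul0r// mul1r; apply: eq_bigr => j ji.
  by rewrite /P (negPf ji).
rewrite sum_dffun_prod (bigD1 i) //= {1}/P eqxx.
rewrite (bigD1 a) //= eqxx big1 ?addr0 ?mul1r; last first.
  by move=> x /negPf xa; rewrite eq_Tagged /= xa.
rewrite big1// => j ji; rewrite /P (negPf ji).
by case: (mix_dist p j).
Qed.

(* u_i(a, p_{-i}) *)
Definition payoff_lottery (G : game) (p : profile G) (i : 'I_n) (a : acts G i) :
    lottery R :=
  law (fun b => payoff b i) (deviation_dist p a).

Definition compose (G H : game) : game := {|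
  acts := fun i => pairs (acts G i) (acts H i);
  acts_neq0 := fun i => pairs_neq0 (acts_neq0 G i) (acts_neq0 H i);
  payoff := fun c i =>
    payoff (g := G) [ffun j => (unpair (c j)).1] i
    + payoff (g := H) [ffun j => (unpair (c j)).2] i
|}.

Lemma composeE (G H : game) (a : {dffun forall i : 'I_n, acts G i})
    (b : {dffun forall i : 'I_n, acts H i}) i :
  payoff (g := compose G H) [ffun j => mkpair (a j, b j)] i =
  payoff a i + payoff b i.
Proof.
by congr (_ + _); apply: (congr1 (fun x => payoff x i)); apply/ffunP => j;
  rewrite !ffunE mkpairK.
Qed.

Lemma compose_dist (G H : game) (p : profile G) (q : profile H) i :
  is_dist (fun c : acts (compose G H) i =>
    p i (unpair c).1 * q i (unpair c).2).
Proof.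
have [pq0 pq1] := dist_prod (mix_dist p i) (mix_dist q i).
split=> [c|]; first exact: (pq0 (unpair c)).
rewrite -[RHS]pq1 [RHS](reindex (@unpair _ _ _)) //=.
exact/onW_bij/(Bijective (@unpairK _ _ _) (@mkpairK _ _ _)).
Qed.

Definition compose_profile (G H : game) (p : profile G) (q : profile H) :
    profile (compose G H) := Profile (compose_dist p q).

(* A profile of the permuted game has the action of player [s i] in coordinate
   [i]; the cast moves b_(s^-1 j), an action of player s (s^-1 j), to player j. *)
Definition unpermute (G : game) (s : {perm 'I_n})
    (b : {dffun forall i : 'I_n, acts G (s i)}) :
    {dffun forall j : 'I_n, acts G j} :=
  [ffun j => ecast k (acts G k) (permKV s j) (b (s^-1%g j))].

Definition permute (G : game) (s : {perm 'I_n}) : game := {|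
  acts := fun i => acts G (s i);
  acts_neq0 := fun i => acts_neq0 G (s i);
  payoff := fun b i => payoff (g := G) (unpermute b) (s i)
|}.

Lemma permuteE (G : game) (s : {perm 'I_n})
    (a : {dffun forall j : 'I_n, acts G j}) i :
  payoff (g := permute G s) [ffun j => a (s j)] i = payoff a (s i).
Proof.
apply: (congr1 (fun x => payoff x (s i))); apply/ffunP => j; rewrite !ffunE.
by move: (s _) (permKV s j) => k e; case: _ / e.
Qed.

Definition permute_profile (G : game) (s : {perm 'I_n}) (p : profile G) :
    profile (permute G s) :=
  @Profile (permute G s) (fun i => p (s i)) (fun i => mix_dist p (s i)).

Record solution_concept := SolutionConcept {
  sol :> forall G : game, set (profile G);
  sol_nonempty : forall G, (@sol G !=set0)%classic
}.
#[global] Arguments sol S G _ : clear implicits, rename.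

Definition refinement (S S' : solution_concept) : Prop :=
  forall G, (S G `<=` S' G)%classic.

Definition permits_bracketing (S : solution_concept) : Prop :=
  forall (G H : game) (p : profile G) (q : profile H),
    S G p -> S H q -> S (compose G H) (compose_profile p q).

Definition distribution_monotone (S : solution_concept) : Prop :=
  forall (G : game) (p : profile G) (i : 'I_n) (a b : acts G i),
    S G p ->
    fosd_gt (payoff_lottery p a) (payoff_lottery p b) -> p i b <= p i a.

Definition anonymous (S : solution_concept) : Prop :=
  forall (G : game) (s : {perm 'I_n}) (p : profile G),
    S G p -> S (permute G s) (permute_profile s p).

Definition nash_eq (Phi : lottery R -> R) (G : game) : set (profile G) :=
  [set p : profile G | forall (i : 'I_n) (a : acts G i), p i a != 0 ->
    forall b : acts G i,
      Phi (payoff_lottery p b) <= Phi (payoff_lottery p a)]%classic.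

#[global] Arguments nash_eq Phi G _ : clear implicits.

Definition lqre_eq (lambda : R) (Phi : lottery R -> R) (G : game) :
    set (profile G) :=
  [set p : profile G | forall i : 'I_n, exists c : R, forall a : acts G i,
    p i a = c * expR (lambda * Phi (payoff_lottery p a))]%classic.

#[global] Arguments lqre_eq lambda Phi G _ : clear implicits.

Definition is_SRE (S : solution_concept) : Prop :=
  (exists2 Phi, is_mon_add_stat Phi & forall G, S G = nash_eq Phi G) \/
  (exists Phi, exists lambda : R, [/\ is_mon_add_stat Phi, 0 <= lambda &
    forall G, S G = lqre_eq lambda Phi G]).

End Games.

Arguments game : clear implicits.
Arguments solution_concept : clear implicits.

(* Main.v *)
Require Import Defs.
From HB Require Import structures.
From mathcomp Require Import all_boot all_order all_algebra all_fingroup.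
From mathcomp Require Import finmap ring lra.
From mathcomp Require Import boolp classical_sets cardinality reals.
From mathcomp Require Import sequences exp.

(** Record every comparison that [S] makes: lotteries [X] and [Y] of two actions
of a player, together with their probabilities [x] and [y].  By anonymity the
player does not matter; by bracketing the records are closed under convolving
lotteries and multiplying probabilities; by monotonicity [X] dominating [Y]
strictly forces [x >= y].  If some probability is 0, comparing multiples shows
that no record with [x > 0] has [X] dominated by [Y] up to a positive
constant.  If all probabilities are positive, the game with sure payoffs 1 and 0
calibrates a slope [lambda], and [ln x - ln y] behaves like [lambda] times a
sure amount.  In both cases the records generate a preorder on the monoid of
lotteries that still orders sure payoffs correctly.  A maximal such preorder is
total, and the supremum of the sure payoffs below [X] is then the required
statistic. *)

Set Implicit Arguments.
Unset Strict Implicit.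
Unset Printing Implicit Defensive.

Import Order.TTheory GRing.Theory Num.Theory.
Local Open Scope ring_scope.

Lemma natr_gt (R : realType) (x : R) : exists k : nat, x < k%:R.
Proof.
exists (Num.bound `|x|).
exact: le_lt_trans (ler_norm _) (archi_boundP (normr_ge0 _)).
Qed.

(** * Preorders on a commutative monoid with sure amounts [iota c] *)

Section PreorderedMonoid.
Variables (R : realType) (M : nmodType) (iota : R -> M).
Hypothesis iota0 : iota 0 = 0.
Hypothesis iotaD : {morph iota : c d / c + d}.

Lemma iotaMn c k : iota (c *+ k) = iota c *+ k.
Proof. by elim: k => [|k IH]; rewrite ?mulr0n // !mulrS iotaD IH. Qed.

(** [cp_iota] only forbids wrong rankings of sure amounts; once the preorder is total, all correct
    rankings follow. *)
Record consistent_preorder (le : set (M * M)) : Prop := ConsistentPreorder {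
  cp_refl : forall X, le (X, X);
  cp_trans : forall X Y Z, le (X, Y) -> le (Y, Z) -> le (X, Z);
  cp_add : forall X Y Z, le (X, Y) -> le (X + Z, Y + Z);
  cp_iota : forall c d, le (iota c, iota d) -> c <= d }.

Lemma cp_addm le X Y X' Y' : consistent_preorder le ->
  le (X, Y) -> le (X', Y') -> le (X + X', Y + Y').
Proof.
move=> cp XY XY'; apply: (cp_trans cp (cp_add cp _ XY)).
by rewrite ![Y + _]addrC; apply: cp_add.
Qed.

Lemma cp_mulrn le X Y k : consistent_preorder le ->
  le (X, Y) -> le (X *+ k, Y *+ k).
Proof.
move=> cp XY; elim: k => [|k IH]; first by rewrite !mulr0n; apply: cp_refl.
by rewrite !mulrS; apply: cp_addm.
Qed.

(* [adjoin le (A, B)] is the preorder generated by [le] and [B <= A]. *)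
Definition adjoin (le : set (M * M)) (p : M * M) : set (M * M) :=
  [set q | exists k, le (q.1 + p.1 *+ k, q.2 + p.2 *+ k)]%classic.

Lemma adjoin_preorder le A B : consistent_preorder le ->
  (forall c d, adjoin le (A, B) (iota c, iota d) -> c <= d) ->
  consistent_preorder (adjoin le (A, B)).
Proof.
move=> cp cons; split=> //.
- by move=> X; exists 0%N; rewrite !mulr0n; apply: cp_refl.
- move=> X Y Z [k /= XY] [l /= YZ]; exists (k + l)%N.
  rewrite /= !mulrnDr !addrA.
  apply: (cp_trans cp (cp_add cp (A *+ l) XY)).
  by rewrite ![_ + B *+ k + _]addrAC; apply: cp_add.
- move=> X Y Z [k /= XY]; exists k => /=; rewrite ![_ + Z + _]addrAC.
  exact: cp_add.
Qed.

(** An Archimedean condition, which keeps the later suprema finite. *)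
Definition bounded (le : set (M * M)) : Prop :=
  forall X, exists c, le (iota (- c), X) /\ le (X, iota c).

Lemma bounded_sub le le' : (le `<=` le')%classic -> bounded le -> bounded le'.
Proof.
by move=> sub bd X; have [c [cX Xc]] := bd X; exists c; split; apply: (sub).
Qed.

(** If [d < c], exchanging copies of [iota c] for [iota d] one at a time, with [Z] as a catalyst,
    ranks [iota (c *+ m) + Z] below [iota (d *+ m) + Z] for every [m]. Removing [Z] costs only
    [K + K], less than [m (c - d)] for large [m]. *)
Lemma cp_cancel le c d Z : consistent_preorder le -> bounded le ->
  le (iota c + Z, iota d + Z) -> c <= d.
Proof.
move=> cp bd H; rewrite leNgt; apply/negP => dc.
have Hm m : le (iota (c *+ m) + Z, iota (d *+ m) + Z).
  elim: m => [|m IH]; first by rewrite !mulr0n; apply: cp_refl.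
  rewrite !mulrSr !iotaD.
  apply: (@cp_trans _ cp _ (iota (c *+ m) + (iota d + Z))).
    by rewrite -addrA ![iota (c *+ m) + _]addrC; apply: cp_add.
  rewrite addrCA -[iota (d *+ m) + _ + _]addrA [iota (d *+ m) + _]addrCA.
  by rewrite ![iota d + _]addrC; apply: cp_add.
have [K [KZ ZK]] := bd Z.
have [m] := natr_gt ((K + K) / (c - d)).
rewrite ltr_pdivrMr ?subr_gt0 // => Km.
suff : c *+ m + (- K) <= d *+ m + K.
  by rewrite -[c *+ m]mulr_natl -[d *+ m]mulr_natl; lra.
idtac.
apply: (cp_iota cp); rewrite !iotaD.
apply: (@cp_trans _ cp _ (iota (c *+ m) + Z)).
  by rewrite ![iota (c *+ m) + _]addrC; apply: cp_add.
apply: (cp_trans cp (Hm m)).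
by rewrite ![iota (d *+ m) + _]addrC; apply: cp_add.
Qed.

(** Zorn's lemma gives a maximal preorder. If it left [X] and [Y] incomparable, adjoining either
    comparison would misorder two sure amounts; the two failures together contradict [cp_cancel]. *)
Lemma total_extension le : consistent_preorder le -> bounded le ->
  exists le' : set (M * M), [/\ consistent_preorder le', (le `<=` le')%classic &
    forall X Y, le' (X, Y) \/ le' (Y, X)].
Proof.
move=> cple bdle.
pose P (Q : set (M * M)) := consistent_preorder Q /\ (le `<=` Q)%classic.
pose leT (Q Q' : {Q | P Q}) := `[< (sval Q `<=` sval Q')%classic >].
have leTP Q Q' : reflect (sval Q `<=` sval Q')%classic (leT Q Q').
  exact: asboolP.
have [|||F Ftot|[Q [cpQ leQ]] Qmax] := @Zorn {Q | P Q} leT.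
- by move=> Q; apply/leTP.
- by move=> Q1 Q2 Q3 /leTP Q12 /leTP Q23; apply/leTP => x /Q12 /Q23.
- move=> [Q PQ] [Q' PQ'] /leTP QQ' /leTP Q'Q.
  exact/eq_exist/seteqP.
- have [->|/set0P[Q0 FQ0]] := eqVneq F set0.
    by exists (exist P le (conj cple (fun _ => id))).
  pose V : set (M * M) := [set x | exists2 Q, F Q & sval Q x]%classic.
  have cpV : consistent_preorder V.
    split.
    + by move=> X; exists Q0 => //; apply: cp_refl; case: (proj2_sig Q0).
    + move=> X Y Z [Q1 FQ1 XY] [Q2 FQ2 YZ].
      case: (Ftot Q1 Q2 FQ1 FQ2) => /leTP Q12.
        exists Q2 => //; apply: (cp_trans _ (Q12 _ XY) YZ).
        by case: (proj2_sig Q2).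
      exists Q1 => //; apply: (cp_trans _ XY (Q12 _ YZ)).
      by case: (proj2_sig Q1).
    + move=> X Y Z [Q1 FQ1 XY]; exists Q1 => //; apply: cp_add => //.
      by case: (proj2_sig Q1).
    + move=> c d [Q1 FQ1 cd]; apply: cp_iota cd.
      by case: (proj2_sig Q1).
  have leV : (le `<=` V)%classic.
    by move=> x lex; exists Q0 => //; case: (proj2_sig Q0) => _; apply.
  exists (exist P V (conj cpV leV)) => Q FQ; apply/leTP => x Qx /=.
  by exists Q.
exists Q; split=> // X Y.
(* By maximality, [(B, A)] can be missing only if adjoining it is inconsistent; the second
   alternative is the witness of that. *)
have key A B : Q (B, A) \/
    exists c d k, [/\ Q (iota c + A *+ k, iota d + B *+ k) & d < c].
  have [cons|] :=
      pselect (forall c d, adjoin Q (A, B) (iota c, iota d) -> c <= d).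
    left; have cpA := adjoin_preorder cpQ cons.
    have QA : (Q `<=` adjoin Q (A, B))%classic.
      by move=> [X' Y'] XY; exists 0%N; rewrite !mulr0n !addr0.
    have leA : (le `<=` adjoin Q (A, B))%classic by move=> x /leQ /QA.
    have := Qmax (exist P _ (conj cpA leA)) => /(_ _)/(congr1 sval) /= <-.
      by exists 1%N; rewrite /= !mulr1n addrC; apply: cp_refl.
    exact/leTP.
  move=> /existsNP[c] /existsNP[d] /not_implyP[[k H]] /negP.
  rewrite -ltNge => dc.
  by right; exists c, d, k.
case: (key Y X) => [|[c [d [k [H dc]]]]]; first by left.
case: (key X Y) => [|[c' [d' [k' [H' dc']]]]]; first by right.
exfalso.
(* A failure that uses zero adjoined copies would already lie in [Q]. *)
case: k k' H H' => [|k] [|k'] H H'; rewrite ?mulr0n ?addr0 in H H'.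
- by move: dc; rewrite ltNge (cp_iota cpQ H).
- by move: dc; rewrite ltNge (cp_iota cpQ H).
- by move: dc'; rewrite ltNge (cp_iota cpQ H').
have bdQ := bounded_sub leQ bdle.
(* Crosswise multiples put equally many copies of [X] and [Y] on both sides, ready to be
   cancelled. *)
have := cp_addm cpQ (cp_mulrn k'.+1 cpQ H) (cp_mulrn k.+1 cpQ H').
rewrite !mulrnDl -!mulrnA [(k'.+1 * _)%N]mulnC.
rewrite [X in Q (X, _)]addrACA [X in Q (_, X)]addrACA -!iotaMn -!iotaD.
rewrite [X *+ _ + _]addrC.
move=> /(cp_cancel cpQ bdQ); rewrite leNgt => /negP; apply.
by apply: ltrD; rewrite ltrMn2r.
Qed.

(** [Phi X] is the supremum of the sure amounts below [X] in a total extension. By totality every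
    amount above the supremum lies above [X], so both halves of additivity follow by
    approximation. *)
Lemma additive_extension le : consistent_preorder le -> bounded le ->
  exists Phi : M -> R, [/\ forall c, Phi (iota c) = c,
    {morph Phi : X Y / X + Y} & forall X Y, le (X, Y) -> Phi X <= Phi Y].
Proof.
move=> cple bdle; have [Q [cp leQ tot]] := total_extension cple bdle.
have bd := bounded_sub leQ bdle.
have mon c d : c <= d -> Q (iota c, iota d).
  move=> cd; case: (tot (iota c) (iota d)) => // dc.
  have -> : c = d by apply/le_anti; rewrite cd (cp_iota cp dc).
  exact: cp_refl.
pose E X := [set c | Q (iota c, X)]%classic.
have Eub X c : Q (X, iota c) -> ubound (E X) c.
  by move=> Xc d /= dX; apply: (cp_iota cp); apply: cp_trans Xc.
have supE X : has_sup (E X).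
  by have [c [cX Xc]] := bd X; split; [exists (- c)|exists c; exact: Eub].
have ltsup X c : c < sup (E X) -> Q (iota c, X).
  move=> cs; have [d Ed cd] : exists2 d, E X d & c < d.
    have e0 : 0 < sup (E X) - c by rewrite subr_gt0.
    have [d Ed cd] := sup_adherent e0 (supE X).
    by exists d => //; rewrite subKr in cd.
  exact: (cp_trans cp (mon _ _ (ltW cd)) Ed).
have gtsup X c : sup (E X) < c -> Q (X, iota c).
  move=> sc; case: (tot X (iota c)) => // /(sup_upper_bound (supE X)).
  by rewrite leNgt sc.
exists (fun X => sup (E X)); split.
- move=> c; apply/le_anti/andP; split.
    by apply: ge_sup; [case: (supE (iota c))|apply: Eub; exact: cp_refl].
  by apply: sup_upper_bound => //; exact: cp_refl.
- move=> X Y /=; apply/le_anti/andP; split.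
    rewrite leNgt; apply/negP => XY.
    (* An error [e] for each of the two summands uses up only half of the gap. *)
    pose e := (sup (E (X + Y)) - (sup (E X) + sup (E Y))) / 4.
    have e0 : 0 < e by rewrite divr_gt0 ?subr_gt0.
    have h1 := gtsup X (sup (E X) + e) (ltr_pwDr e0 (lexx _)).
    have h2 := gtsup Y (sup (E Y) + e) (ltr_pwDr e0 (lexx _)).
    have h := cp_addm cp h1 h2; rewrite -iotaD in h.
    have := ge_sup (proj1 (supE (X + Y))) (Eub _ _ h).
    by rewrite /e in e0 *; lra.
  rewrite leNgt; apply/negP => XY.
  pose e := (sup (E X) + sup (E Y) - sup (E (X + Y))) / 4.
  have e0 : 0 < e by rewrite divr_gt0 ?subr_gt0.
  have sub_e x : x - e < x by rewrite ltrBlDr ltrDl.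
  have h1 := ltsup X (sup (E X) - e) (sub_e _).
  have h2 := ltsup Y (sup (E Y) - e) (sub_e _).
  have h := cp_addm cp h1 h2; rewrite -iotaD in h.
  by have := sup_upper_bound (supE (X + Y)) h; rewrite /e in e0 *; lra.
- move=> X Y XY; apply: ge_sup; first by case: (supE X).
  move=> c cX; apply: sup_upper_bound => //=.
  exact: (cp_trans cp cX (leQ _ XY)).
Qed.

End PreorderedMonoid.

(** * The monoid of lotteries under convolution, ordered by stochastic dominance *)

Section LotteryMonoid.
Context {R : realType}.
Implicit Types (X Y Z : lottery R) (g : R -> R).

(** Testing against arbitrary [g] turns identities of lotteries into identities of finite sums, by
    [lottery_ext]. *)
Definition expect X g : R := \sum_(x : finsupp X) X (val x) * g (val x).

Lemma expectE X (A : {fset R}) g : (finsupp X `<=` A)%fset ->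
  expect X g = \sum_(x <- A) X x * g x.
Proof.
move=> XA; rewrite /expect -(big_seq_fsetE _ _ xpredT (fun x => X x * g x)) /=.
apply: big_fset_incl => // x _ xX; by rewrite fsfun_dflt // mul0r.
Qed.

Lemma expect_law (T : finType) (mu : T -> R) f (mu_dist : is_dist mu) g :
  expect (law f mu_dist) g = \sum_t mu t * g (f t).
Proof.
set A := [fset f t | t in T]%fset.
rewrite (@expectE _ A) => [|/=]; last first.
  apply/fsubsetP => x; rewrite mem_finsupp fsfun_fun.
  by case: ifPn; rewrite ?eqxx.
under eq_bigr do rewrite /= law_funE big_mkcond mulr_suml.
rewrite exchange_big /=; apply: eq_bigr => t _.
have tA : f t \in A by apply/imfsetP; exists t.
rewrite (bigD1_seq _ tA (fset_uniq _)) /= eqxx big1 ?addr0// => x.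
by rewrite eq_sym => /negPf ->; rewrite mul0r.
Qed.

Lemma expect_sure c g : expect (sure c) g = g c.
Proof. by rewrite expect_law (big_pred1 tt) ?mul1r // => -[]. Qed.

Lemma expect_conv X Y g :
  expect (convolution X Y) g =
  expect X (fun x => expect Y (fun y => g (x + y))).
Proof.
rewrite expect_law -(pair_bigA _ (fun (x : finsupp X) (y : finsupp Y) =>
  X (val x) * Y (val y) * g (val x + val y))) /=.
apply: eq_bigr => x _; rewrite /expect mulr_sumr; apply: eq_bigr => y _.
by rewrite mulrA.
Qed.

Lemma eq_expect X g h : g =1 h -> expect X g = expect X h.
Proof. by move=> gh; apply: eq_bigr => x _; rewrite gh. Qed.

Lemma le_expect X g h : (forall x, g x <= h x) -> expect X g <= expect X h.
Proof. by move=> gh; apply: ler_sum => x _; rewrite ler_wpM2l ?pmf_ge0. Qed.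

Lemma expect_exchange X Y (h : R -> R -> R) :
  expect X (fun x => expect Y (h x)) = expect Y (fun y => expect X (h ^~ y)).
Proof.
rewrite /expect; under eq_bigr do rewrite mulr_sumr.
rewrite exchange_big; apply: eq_bigr => y _; rewrite mulr_sumr.
by apply: eq_bigr => x _; rewrite mulrCA.
Qed.

Lemma expect_indic X (p : pred R) :
  expect X (fun x => (p x)%:R) = \sum_(x <- finsupp X | p x) X x.
Proof.
rewrite (expectE _ (fsubset_refl _)) [RHS]big_mkcond.
by apply: eq_bigr => x _; case: (p x); rewrite ?mulr1 ?mulr0.
Qed.

Lemma tailE X t : tail X t = expect X (fun x => (t < x)%R%:R).
Proof. by rewrite expect_indic. Qed.

Lemma lottery_ext X Y : (forall g, expect X g = expect Y g) -> X = Y.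
Proof.
have pmfE Z r : Z r = expect Z (fun x => (x == r)%:R).
  rewrite (expectE _ (fsubset_refl _)); have [rZ|rZ] := boolP (r \in finsupp Z).
    rewrite (bigD1_seq r) ?fset_uniq //= eqxx mulr1 big1 ?addr0 // => x.
    by move=> /negPf ->; rewrite mulr0.
  rewrite big_seq big1 ?fsfun_dflt // => x xZ; case: eqP => [xr|_].
    by rewrite -xr xZ in rZ.
  by rewrite mulr0.
by move=> XY; apply/pmf_inj/fsfunP => r; rewrite !pmfE XY.
Qed.

Fact convA : associative (@convolution R).
Proof.
move=> X Y Z; apply: lottery_ext => g; rewrite !expect_conv.
apply: eq_expect => x; rewrite expect_conv; apply: eq_expect => y.
by apply: eq_expect => z; rewrite addrA.
Qed.

Fact convC : commutative (@convolution R).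
Proof.
move=> X Y; apply: lottery_ext => g; rewrite !expect_conv expect_exchange.
by apply: eq_expect => x; apply: eq_expect => y; rewrite addrC.
Qed.

Fact conv0 : left_id (sure (0 : R)) (@convolution R).
Proof.
move=> X; apply: lottery_ext => g; rewrite expect_conv expect_sure.
by apply: eq_expect => x; rewrite add0r.
Qed.

(** From here on [X + Y] is convolution, [0] is [sure 0], and [X *+ k] is the sum of [k] independent
    copies. *)
HB.instance Definition _ := gen_eqMixin (lottery R).
HB.instance Definition _ := gen_choiceMixin (lottery R).
HB.instance Definition _ := GRing.isNmodule.Build (lottery R) convA convC conv0.

Lemma expectD X Y g :
  expect (X + Y) g = expect X (fun x => expect Y (fun y => g (x + y))).
Proof. exact: expect_conv. Qed.

Lemma sureD : {morph (@sure R) : c d / c + d}.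
Proof.
by move=> c d; apply: lottery_ext => g; rewrite expectD !expect_sure.
Qed.

Lemma sure0 : sure (0 : R) = 0. Proof. by []. Qed.

Lemma fosd_refl X : fosd_ge X X. Proof. by move=> t. Qed.

Lemma fosd_trans X Y Z : fosd_ge X Y -> fosd_ge Y Z -> fosd_ge X Z.
Proof. by move=> XY YZ t; apply: le_trans (YZ t) (XY t). Qed.

(** Conditioning on the draw [z] of [Z], the tail of a sum at [t] is an average of tails at
    [t - z]. *)
Lemma fosd_add X Y Z : fosd_ge X Y -> fosd_ge (X + Z) (Y + Z).
Proof.
have tailD W t : tail (W + Z) t = expect Z (fun z => tail W (t - z)).
  rewrite tailE expectD expect_exchange; apply: eq_expect => z; rewrite tailE.
  by apply: eq_expect => x; rewrite ltrBlDr.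
by move=> XY t; rewrite !tailD; apply: le_expect => z; apply: XY.
Qed.

Lemma fosd_sure (c d : R) : fosd_ge (sure d) (sure c) <-> c <= d.
Proof.
split=> [/(_ d)|cd t]; rewrite !tailE !expect_sure.
  by rewrite ltxx ler_nat leNgt; case: (d < c).
by rewrite ler_nat; case: (ltP t c) => // tc; rewrite (lt_le_trans tc cd).
Qed.

Definition fosd_le : set (lottery R * lottery R) :=
  [set p | fosd_ge p.2 p.1]%classic.

Lemma fosd_preorder : consistent_preorder (@sure R) fosd_le.
Proof.
split=> [X|X Y Z XY YZ|X Y Z|c d].
- exact: fosd_refl.
- exact: fosd_trans YZ XY.
- exact: fosd_add.
- by move/fosd_sure.
Qed.

Lemma fosd_bounded : bounded (@sure R) fosd_le.
Proof.
move=> X; have [c cX] : exists c, forall x, x \in finsupp X -> `|x| <= c.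
  exists (\sum_(x <- finsupp X) `|x|) => x xX.
  by rewrite (bigD1_seq x) ?fset_uniq //= lerDl sumr_ge0.
have tail1 t : tail X t <= 1.
  rewrite -(pmf_sum1 X) /tail big_mkcond ler_sum // => x _.
  by case: ifP => _ //; exact: pmf_ge0.
have tail0 t : 0 <= tail X t by apply: sumr_ge0 => x _; exact: pmf_ge0.
exists c; split=> t /=; rewrite [tail (sure _) t]tailE expect_sure.
  case: ltP => // tc.
  rewrite -{1}(pmf_sum1 X) /tail big_seq [leRHS]big_seq_cond.
  rewrite le_eqVlt; apply/orP; left; apply/eqP/eq_bigl => x.
  case: (boolP (x \in _)) => //= xX.
  by rewrite (lt_le_trans tc) // lerNl (le_trans (ler_norm _)) // normrN cX.
case: ltP => // ct; rewrite /tail big_seq_cond big1 // => x /andP[xX tx].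
have := le_lt_trans (cX x xX) (le_lt_trans ct tx).
by rewrite ltNge ler_norm.
Qed.

(** A positive margin makes dominance strict: if [X = Y], cancelling [Y] would give [e <= 0]. *)
Lemma fosd_gt_shift X Y (e : R) :
  0 < e -> fosd_ge X (Y + sure e) -> fosd_gt X Y.
Proof.
move=> e0 XYe; split=> [|XY].
  apply: (fosd_trans XYe); rewrite -[Y in fosd_ge _ Y]addr0 ![Y + _]addrC.
  by apply: fosd_add; apply/fosd_sure/ltW.
have : fosd_le (sure e + Y, sure 0 + Y).
  by rewrite sure0 add0r addrC /fosd_le /= -{1}XY.
move/(cp_cancel sureD fosd_preorder fosd_bounded); rewrite leNgt e0 //.
Qed.

End LotteryMonoid.

(** * Records of comparisons and their closure properties *)

Section GameOperations.
Context {n : nat} {R : realType} {U : actionUniverse}.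
Implicit Types G H : game n R U.

(** Action profiles of the composite game are pairs of action profiles, and the weights in
    [deviation] factor along this bijection. *)
Lemma payoff_lottery_compose G H (p : profile G) (q : profile H) i
    (a : acts G i) (b : acts H i) :
  payoff_lottery (compose_profile p q) (mkpair (a, b) : acts (compose G H) i) =
  payoff_lottery p a + payoff_lottery q b.
Proof.
apply: lottery_ext => g; rewrite expect_conv !expect_law.
under [RHS]eq_bigr do rewrite expect_law mulr_sumr.
rewrite pair_bigA /=.
pose h (c : {dffun forall j, acts G j} * {dffun forall j, acts H j}) :
    {dffun forall j, acts (compose G H) j} := [ffun j => mkpair (c.1 j, c.2 j)].
pose h' (c : {dffun forall j, acts (compose G H) j}) :
    {dffun forall j, acts G j} * {dffun forall j, acts H j} :=
  ([ffun j => (unpair (c j)).1], [ffun j => (unpair (c j)).2]).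
have hK : cancel h h'.
  by move=> [c c']; congr pair; apply/ffunP => j; rewrite !ffunE mkpairK.
have h'K : cancel h' h.
  by move=> c; apply/ffunP => j; rewrite !ffunE -surjective_pairing unpairK.
rewrite (reindex h) /=; last exact/onW_bij/(Bijective hK h'K).
apply: eq_bigr => -[c c'] _; rewrite mulrA.
congr (_ * g _); last exact: (composeE c c').
rewrite /deviation !ffunE (inj_eq (@mkpair_inj _ _ _)) xpair_eqE /=.
case: eqP => _; rewrite ?mul0r //=; case: eqP => _; rewrite ?mulr0 //=.
by rewrite -big_split; apply: eq_bigr => j _ /=; rewrite !ffunE mkpairK.
Qed.

Lemma payoff_lottery_permute G (s : {perm 'I_n}) (p : profile G) i
    (a : acts G (s i)) :
  payoff_lottery (permute_profile s p) (a : acts (permute G s) i) =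
  payoff_lottery p a.
Proof.
apply: lottery_ext => g; rewrite !expect_law.
pose h (c : {dffun forall j, acts G j}) :
    {dffun forall j, acts (permute G s) j} :=
  [ffun j => c (s j)].
have hK : cancel h (@unpermute _ _ _ G s).
  move=> c; apply/ffunP => j; rewrite !ffunE.
  by move: (s _) (permKV s j) => k e; case: _ / e.
have h'K : cancel (@unpermute _ _ _ G s) h.
  move=> c; apply/ffunP => j; rewrite !ffunE.
  (* Generalizing the index together with its proof leaves a cast along a proof of [s j = s j],
     which is trivial. *)
  have : s^-1%g (s j) = j by rewrite permK.
  move: (s^-1%g (s j)) (permKV s (s j)) => k e kj; subst k.
  by rewrite (eq_irrelevance e erefl).
rewrite (reindex h) /=; last exact/onW_bij/(Bijective hK h'K).
apply: eq_bigr => c _; congr (_ * g _); last exact: (@permuteE _ _ _ G s c).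
rewrite /deviation ffunE; case: eqP => _ //.
rewrite [RHS](reindex_inj (@perm_inj _ s)) /=; apply: eq_big => j.
  by rewrite (inj_eq perm_inj).
by rewrite ffunE.
Qed.

Definition observed (S : solution_concept n R U) (i : 'I_n)
    (X Y : lottery R) (x y : R) : Prop :=
  exists (G : game n R U) (p : profile G) (a b : acts G i),
    [/\ S G p, X = payoff_lottery p a, Y = payoff_lottery p b,
      x = p i a & y = p i b].

Variable S : solution_concept n R U.

Lemma observed_sym i X Y x y : observed S i X Y x y -> observed S i Y X y x.
Proof. by move=> [G [p [a [b [? ? ? ? ?]]]]]; exists G, p, b, a. Qed.

Lemma observed_ge0 i X Y x y : observed S i X Y x y -> 0 <= x.
Proof. by move=> [G [p [a [b [_ _ _ -> _]]]]]; case: (mix_dist p i). Qed.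

Lemma observedD i X Y x y X' Y' x' y' : permits_bracketing S ->
  observed S i X Y x y -> observed S i X' Y' x' y' ->
  observed S i (X + X') (Y + Y') (x * x') (y * y').
Proof.
move=> brS [G [p [a [b [SG -> -> -> ->]]]]] [H [q [a' [b' [SH -> -> -> ->]]]]].
exists (compose G H), (compose_profile p q), (mkpair (a, a')), (mkpair (b, b')).
by rewrite !payoff_lottery_compose /= !mkpairK; split=> //; apply: brS.
Qed.

Lemma observedMn i X Y x y k : permits_bracketing S ->
  observed S i X Y x y ->
  observed S i (X *+ k.+1) (Y *+ k.+1) (x ^+ k.+1) (y ^+ k.+1).
Proof.
move=> brS XY; elim: k => [|k IH] //.
by rewrite !(mulrS _ k.+1) !(exprS _ k.+1); apply: observedD.
Qed.

Lemma observed_mono i X Y x y : distribution_monotone S ->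
  observed S i X Y x y -> fosd_gt X Y -> y <= x.
Proof. by move=> moS [G [p [a [b [SG -> -> -> ->]]]]]; apply: moS. Qed.

(** After the transposition of [i] and [j], player [j] takes the role of player [i]. *)
Lemma observed_anon i j X Y x y : anonymous S ->
  observed S i X Y x y -> observed S j X Y x y.
Proof.
move=> anS; rewrite -{1}(tpermL j i) => -[G [p [a [b [SG -> -> -> ->]]]]].
exists (permute G (tperm j i)), (permute_profile (tperm j i) p), a, b.
by rewrite !payoff_lottery_permute; split=> //; apply: anS.
Qed.

(** In the game used here each player's payoff depends on the own action alone, so the lotteries are
    sure whatever the others play; two distinct actions exist because [U] is infinite. *)
Lemma observed_unit i :
  exists x y, observed S i (sure 1) (sure 0) x y /\ x + y = 1.
Proof.
have [u0 [u1 u01]] : exists u0 u1 : U, u0 != u1.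
  apply: contrapT => H; apply: (@act_infinite U).
  case: (pselect (exists u : U, True)) => [[u _]|U0].
    apply: (sub_finite_set _ (finite_set1 u)) => v _ /=.
    by apply: contrapT => uv; apply: H; exists v, u; apply/eqP.
  by apply: (sub_finite_set _ (finite_set0 _)) => v _; apply: U0; exists v.
have A0 (_ : 'I_n) : [fset u0; u1]%fset != fset0.
  by apply/fset0Pn; exists u0; rewrite !inE eqxx.
pose H := @Game n R U _ A0 (fun c j => (val (c j) == u1)%:R).
have [q Sq] := sol_nonempty S H.
have u0A : u0 \in [fset u0; u1]%fset by rewrite !inE eqxx.
have u1A : u1 \in [fset u0; u1]%fset by rewrite !inE eqxx orbT.
pose b0 : acts H i := [` u0A]%fset; pose b1 : acts H i := [` u1A]%fset.
have lot a : payoff_lottery q (a : acts H i) = sure (val a == u1)%:R.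
  apply: lottery_ext => g; rewrite expect_law expect_sure.
  transitivity (\sum_c deviation q a c * g (val a == u1)%:R).
    apply: eq_bigr => c _; rewrite /deviation; case: eqP => [<- //|_].
    by rewrite !mul0r.
  by rewrite -mulr_suml (proj2 (deviation_dist q a)) mul1r.
exists (q i b1), (q i b0); split.
  exists H, q, b1, b0; split=> //; rewrite lot /= ?eqxx //.
  by rewrite (negPf u01).
rewrite -(proj2 (mix_dist q i)) (bigD1 b1) //=; congr (_ + _).
rewrite (big_pred1 b0) // => c; apply/idP/eqP => [c1|-> //].
  apply/val_inj; move: (valP c) c1; rewrite !inE -val_eqE /=.
  by case/orP => /eqP -> //; rewrite eqxx.
Qed.

End GameOperations.

(** * Monotone additive statistics that satisfy prescribed inequalities *)

Section Statistics.
Context {R : realType}.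
Implicit Types X Y A B : lottery R.

(** Each pair [(A, B)] in [P] demands that [B] rank below [A]. The preorder [le] generated by these
    demands and dominance puts [X] below [Y] when [Y + B] dominates [X + A] for some demand; the
    third hypothesis keeps its ranking of sure amounts correct. *)
Lemma statistic_extension (P : set (lottery R * lottery R)) :
  (exists A, P (A, A)) ->
  (forall A B A' B', P (A, B) -> P (A', B') -> P (A + A', B + B')) ->
  (forall A B c, P (A, B) -> fosd_ge (B + sure c) A -> 0 <= c) ->
  exists2 Phi, is_mon_add_stat Phi & forall A B, P (A, B) -> Phi B <= Phi A.
Proof.
move=> [A0 PA0] PD Pcons.
pose le : set (lottery R * lottery R) :=
  [set q | exists A B, P (A, B) /\ fosd_ge (q.2 + B) (q.1 + A)]%classic.
have leP X Y : fosd_ge Y X -> le (X, Y).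
  by move=> YX; exists A0, A0; split=> //; apply: fosd_add.
have cp : consistent_preorder (@sure R) le.
  split=> [X|X Y Z|X Y Z|c d].
  - exact/leP/fosd_refl.
  - move=> [A [B [PAB /= XY]]] [A' [B' [PAB' /= YZ]]].
    exists (A + A'), (B + B'); split; first exact: PD.
    rewrite /= !addrA; apply: fosd_trans (fosd_add A' XY).
    by rewrite [Z + B + _]addrAC [Y + B + _]addrAC; apply: fosd_add.
  - move=> [A [B [PAB /= XY]]]; exists A, B; split=> //=.
    by rewrite ![_ + Z + _]addrAC; apply: fosd_add.
  - move=> [A [B [PAB /=]]] /(fosd_add (sure (- c))).
    rewrite ![sure _ + _]addrC -!addrA -!sureD subrr sure0 addr0.
    by move/(Pcons _ _ _ PAB); rewrite subr_ge0.
have bd : bounded (@sure R) le.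
  by apply: bounded_sub fosd_bounded => -[X Y]; apply: leP.
have [Phi [Phic PhiD Phile]] := additive_extension sure0 sureD cp bd.
exists Phi; first by split=> // Z W WZ; apply/Phile/leP.
move=> A B PAB; apply: Phile; exists A, B; split=> //=.
by rewrite addrC; apply: fosd_refl.
Qed.

Lemma fosd_mulrn X Y k : fosd_ge X Y -> fosd_ge (X *+ k) (Y *+ k).
Proof. by move=> XY; exact: (cp_mulrn k fosd_preorder XY). Qed.

Lemma sureMn (c : R) k : sure (c *+ k) = sure c *+ k.
Proof. exact: (iotaMn sure0 sureD). Qed.

Lemma sure_dominates X Y : exists k : nat, fosd_gt (X + sure k.+1%:R) Y.
Proof.
have [cX [geX _]] := fosd_bounded X; have [cY [_ leY]] := fosd_bounded Y.
have [k kP] := natr_gt (cX + cY).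
exists k; apply: (@fosd_gt_shift _ _ _ 1) => //.
apply: (@fosd_trans _ _ (sure cY + sure 1)); last exact: fosd_add.
apply: (@fosd_trans _ _ (sure (- cX) + sure k.+1%:R)); first exact: fosd_add.
by rewrite -!sureD; apply/fosd_sure; rewrite -natr1; lra.
Qed.

End Statistics.

(** * The two cases: some zero probability, or all probabilities positive *)

Section Response.
Context {n : nat} {R : realType} {U : actionUniverse}.
Variables (S : solution_concept n R U) (i : 'I_n) (x1 y1 : R).
Hypotheses (brS : permits_bracketing S) (moS : distribution_monotone S).
Hypotheses (unitS : observed S i (sure 1) (sure 0) x1 y1)
  (sum_x1y1 : x1 + y1 = 1).

Lemma observed_units k :
  observed S i (sure k.+1%:R) 0 (x1 ^+ k.+1) (y1 ^+ k.+1).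
Proof.
by have := observedMn k brS unitS; rewrite -!sureMn mul0rn.
Qed.

Lemma observed_unit_le : y1 <= x1.
Proof.
apply: (observed_mono moS unitS); apply: (fosd_gt_shift ltr01).
by rewrite sure0 add0r; apply: fosd_refl.
Qed.

Lemma observed_unit_gt0 : 0 < x1.
Proof. by have := observed_unit_le; have := sum_x1y1; lra. Qed.

Lemma observed_refl X Y x y : observed S i X Y x y -> observed S i X X x x.
Proof. by move=> [G [p [a [b [? ? ? ? ?]]]]]; exists G, p, a, a. Qed.

(** The zero record forces [y1 = 0]. Any record with [x > 0] then becomes a demand that [B] rank
    below [A], and these demands are consistent. *)
Lemma zero_prob_statistic A0 B0 x0 : observed S i A0 B0 x0 0 -> 0 < x0 ->
  exists2 Phi, is_mon_add_stat Phi & forall A B x y,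
    observed S i A B x y -> 0 < x -> Phi B <= Phi A.
Proof.
move=> O0 x0_gt0.
have y10 : y1 = 0.
  (* Raising [B0] by enough units makes it dominate [A0], yet its probability stays 0; hence the
     power of [y1] on the other side vanishes. *)
  have [k BA] := sure_dominates B0 A0.
  have := observedD brS (observed_sym O0) (observed_units k).
  rewrite addr0 => /(observed_mono moS) /(_ BA); rewrite mul0r.
  rewrite pmulr_rle0 // => y1k; apply/eqP; rewrite -[_ == _](expf_eq0 _ k.+1).
  by rewrite eq_le y1k exprn_ge0 // (observed_ge0 (observed_sym unitS)).
have [|||Phi PhiS PhiP] := @statistic_extension R
    [set q | exists x y, observed S i q.1 q.2 x y /\ 0 < x]%classic.
- exists (sure 1), x1, x1; split; last exact: observed_unit_gt0.
  exact: observed_refl unitS.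
- move=> A B A' B' [x [y [AB x0']]] [x' [y' [AB' x'0]]].
  by exists (x * x'), (y * y'); split; [apply: observedD|apply: mulr_gt0].
- move=> A B c [x [y [/= AB x_gt0]]] BA; rewrite leNgt; apply/negP => c0.
  (* Of the 2, one unit offsets the payoff 1 of the unit game and the other is the strict margin.
     The dominating side then has probability 0 because of the factor [y1], the dominated side a
     positive one. *)
  have [k kP] := natr_gt (2 / - c).
  have kc : 2 + c *+ k.+1 <= 0.
    move: kP; rewrite ltr_pdivrMr ?oppr_gt0 //.
    by rewrite -[c *+ _]mulr_natl -[k.+1%:R]natr1; lra.
  have := observedD brS (observedMn k brS (observed_sym AB))
    (observed_sym unitS).
  move=> /(observed_mono moS); rewrite y10 mulr0 => le0.
  suff /le0 : fosd_gt (B *+ k.+1 + sure 0) (A *+ k.+1 + sure 1).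
    rewrite leNgt mulr_gt0 ?exprn_gt0 //; exact: observed_unit_gt0.
  rewrite sure0 addr0; apply: (fosd_gt_shift ltr01).
  have := fosd_add (sure 2) (fosd_mulrn k.+1 BA).
  rewrite mulrnDl -sureMn -!addrA -!sureD => H.
  apply: fosd_trans (H); rewrite -[X in fosd_ge X _]addr0 ![B *+ _ + _]addrC.
  by apply/fosd_add/fosd_sure; rewrite addrC.
by exists Phi => // A B x y AB x_gt0; apply: PhiP; exists x, y.
Qed.

Hypothesis posS : forall A B x y, observed S i A B x y -> 0 < y.

(** The log-odds gained per unit of sure payoff. *)
Let lambda := ln x1 - ln y1.

Let y1_gt0 : 0 < y1. Proof. exact: posS unitS. Qed.

Lemma lambda_ge0 : 0 <= lambda.
Proof.
by rewrite subr_ge0 ler_ln ?posrE ?observed_unit_le ?observed_unit_gt0.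
Qed.

(* Comparing [k] copies of the observation with integer multiples of the unit
   game loses a bounded amount, which vanishes after dividing by [k]. *)
Lemma observed_shift A B x y c : observed S i A B x y ->
  fosd_ge (A + sure c) B -> ln y <= ln x + lambda * c.
Proof.
move=> AB ge_AB; have x_gt0 := posS (observed_sym AB); have y_gt0 := posS AB.
have x1_gt0 := observed_unit_gt0.
have step k : k.+1%:R * (ln y - ln x - lambda * c) <= 2 * lambda.
  (* The integer [j - l] lies above [c *+ k.+1 + 1] and at most at [c *+ k.+1 + 2]: the lower bound
     gives strict dominance, the upper one the error [2 * lambda]. The offset [l] allows for
     negative [c]. *)
  have [l lP] := natr_gt (- (c *+ k.+1)).
  have [j [jle jgt]] : exists j : nat,
      j%:R <= c *+ k.+1 + l%:R + 2 /\ c *+ k.+1 + l%:R + 2 < j%:R + 1.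
    exists (Num.truncn (c *+ k.+1 + l%:R + 2)); rewrite natr1; apply/andP.
    by apply: truncn_itv; lra.
  have := observedD brS (observedMn k brS AB)
    (observedD brS (observed_units j) (observed_sym (observed_units l))).
  move=> /(observed_mono moS); rewrite addr0 add0r => le_prob.
  suff /le_prob :
      fosd_gt (A *+ k.+1 + sure j.+1%:R) (B *+ k.+1 + sure l.+1%:R).
    rewrite -ler_ln ?posrE ?mulr_gt0 ?exprn_gt0 //.
    rewrite !lnM ?posrE ?mulr_gt0 ?exprn_gt0 // !lnXn // => H.
    have lam0 := lambda_ge0.
    have : (j%:R - l%:R) * lambda <= (c *+ k.+1 + 2) * lambda.
      by rewrite ler_wpM2r //; lra.
    have mulSn (z : R) m : z *+ m.+1 = (m%:R + 1) * z.
      by rewrite natr1 mulr_natl.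
    move: H; rewrite !mulSn /lambda; lra.
  pose e := j.+1%:R - l.+1%:R - c *+ k.+1.
  have e0 : 0 < e by rewrite /e -[j.+1%:R]natr1 -[l.+1%:R]natr1; lra.
  apply: (fosd_gt_shift e0).
  have -> : sure j.+1%:R = sure (c *+ k.+1) + (sure l.+1%:R + sure e).
    by rewrite -!sureD /e; congr sure; ring.
  rewrite addrA -[B *+ _ + _ + _]addrA; apply: fosd_add.
  by rewrite sureMn -mulrnDl; apply: fosd_mulrn.
rewrite -subr_ge0 -oppr_le0 leNgt; apply/negP => d0.
have [k kP] := natr_gt (2 * lambda / - (ln x + lambda * c - ln y)).
by move: kP (step k); rewrite ltr_pdivrMr // -[k.+1%:R]natr1; lra.
Qed.

(** For [lambda > 0], each record demands that [A] rank above [B] plus the sure amount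
    [(ln x - ln y) / lambda]; the reversed record gives the opposite inequality. For [lambda = 0],
    all recorded probabilities agree and any statistic serves. *)
Lemma positive_prob_statistic : exists2 Phi, is_mon_add_stat Phi &
  forall A B x y, observed S i A B x y ->
    ln x - ln y = lambda * (Phi A - Phi B).
Proof.
have := lambda_ge0; rewrite le_eqVlt => /orP[/eqP lam0|lam_gt0].
  have [|||Phi PhiS _] := @statistic_extension R [set (0, 0)]%classic.
  - by exists 0.
  - by move=> A B A' B' [-> ->] [-> ->] /=; rewrite !addr0.
  - by move=> A B c [-> ->]; rewrite add0r => /fosd_sure.
  exists Phi => // A B x y AB; rewrite -lam0 mul0r.
  suff le_ln A' B' x' y' : observed S i A' B' x' y' -> ln y' <= ln x'.
    apply/eqP; rewrite subr_eq0 eq_le (le_ln _ _ _ _ AB).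
    by rewrite (le_ln _ _ _ _ (observed_sym AB)).
  move=> AB'; have [k [dom _]] := sure_dominates A' B'.
  by have := observed_shift AB' dom; rewrite -lam0 mul0r addr0.
have [|||Phi PhiS PhiP] := @statistic_extension R
    [set q | exists B x y, observed S i q.1 B x y /\
       q.2 = B + sure ((ln x - ln y) / lambda)]%classic.
- exists (sure 1), (sure 1), x1, x1; split; first exact: observed_refl unitS.
  by rewrite subrr mul0r addr0.
- move=> A B A' B' [C [x [y [/= AC ->]]]] [C' [x' [y' [/= AC' ->]]]].
  exists (C + C'), (x * x'), (y * y'); split=> /=; first exact: observedD.
  have [x0 y0] := (posS (observed_sym AC), posS AC).
  have [x'0 y'0] := (posS (observed_sym AC'), posS AC').
  rewrite addrACA -sureD !lnM ?posrE //; congr (_ + sure _).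
  by rewrite -mulrDl; congr (_ * _); ring.
(* Consistency is [observed_shift] for the reversed record: the log terms cancel and leave
   [0 <= lambda * c]. *)
- move=> A B c [C [x [y [/= AC ->]]]]; rewrite -addrA -sureD.
  move=> /(observed_shift (observed_sym AC)).
  rewrite mulrDr mulrCA divff ?gt_eqF // mulr1 => H.
  by rewrite -(pmulr_rge0 _ lam_gt0); lra.
exists Phi => // A B x y AB.
have half A' B' x' y' : observed S i A' B' x' y' ->
    ln x' - ln y' <= lambda * (Phi A' - Phi B').
  move=> AB'; rewrite mulrC -ler_pdivrMr // lerBrDl.
  rewrite -[X in _ + X](stat_sure PhiS) -(stat_add PhiS).
  by apply: PhiP; exists B', x', y'.
by have := half _ _ _ _ AB; have := half _ _ _ _ (observed_sym AB); lra.
Qed.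

End Response.

(** * Assembly into a Nash or a logit response *)

Theorem theorem2 (n : nat) (R : realType) (U : actionUniverse)
    (S : solution_concept n R U) :
  (2 <= n)%N ->
  permits_bracketing S ->
  distribution_monotone S ->
  anonymous S ->
  exists S' : solution_concept n R U, is_SRE S' /\ refinement S S'.
Proof.
move=> n2 brS moS anS; pose i := Ordinal (ltnW n2).
(* Moving all records to the single player [i] yields one statistic for all players. *)
have obs G p j (a b : acts G j) : S G p ->
    observed S i (payoff_lottery p a) (payoff_lottery p b) (p j a) (p j b).
  by move=> SG; apply: (@observed_anon _ _ _ _ j) => //; exists G, p, a, b.
have [x1 [y1 [unitS sum1]]] := observed_unit S i.
have pos_act (G : game n R U) (p : profile G) j : exists a, 0 < p j a.
  apply: contrapT => H; have [p0 p1] := mix_dist p j.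
  have : \sum_a p j a <= 0.
    apply: sumr_le0 => a _; rewrite leNgt; apply/negP => pa.
    by apply: H; exists a.
  by rewrite p1 ler10.
have [[A [B [x [y [AB y0]]]]]|pos] :=
    pselect (exists A B x y, observed S i A B x y /\ y <= 0).
  move: AB y0 => [G [p [a [b [SG _ _ _ ->]]]]] pb0.
  have {}pb0 : p i b = 0 by apply/le_anti; rewrite pb0 /=; case: (mix_dist p i).
  have [a' pa'] := pos_act G p i.
  have := obs G p i a' b SG; rewrite pb0 => O0.
  have [Phi PhiS PhiP] := zero_prob_statistic brS moS unitS sum1 O0 pa'.
  have sub G' : (S G' `<=` nash_eq Phi G')%classic.
    move=> p' SG' j c pc d; apply: (PhiP _ _ _ _ (obs _ _ _ c d SG')).
    by rewrite lt_def pc /=; case: (mix_dist p' j).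
  (* Existence of equilibria in every game is inherited from [S]. *)
  pose S' := SolutionConcept (fun G' =>
    subset_nonempty (sub G') (sol_nonempty S G')).
  by exists S'; split; [left; exists Phi|exact: sub].
have posS A B x y : observed S i A B x y -> 0 < y.
  by move=> AB; rewrite ltNge; apply/negP => y0; apply: pos; exists A, B, x, y.
have [Phi PhiS PhiP] := positive_prob_statistic brS moS unitS sum1 posS.
set lambda := ln x1 - ln y1 in PhiP.
have sub G : (S G `<=` lqre_eq lambda Phi G)%classic.
  move=> p SG j; have [a0 _] := pos_act G p j.
  (* The normalizing constant is read off at a reference action [a0]; [PhiP] gives the ratio of
     every other probability to [p j a0]. *)
  exists (p j a0 * expR (- (lambda * Phi (payoff_lottery p a0)))) => a.
  have pa := posS _ _ _ _ (obs _ _ _ a0 a SG).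
  have pa0 := posS _ _ _ _ (obs _ _ _ a a0 SG).
  have := PhiP _ _ _ _ (obs _ _ _ a a0 SG).
  rewrite -(lnK pa) -(lnK pa0) !expRK -mulrA -!expRD => E.
  by congr expR; lra.
pose S' := SolutionConcept (fun G =>
  subset_nonempty (sub G) (sol_nonempty S G)).
exists S'; split; last exact: sub; right; exists Phi, lambda; split=> //.
exact: (lambda_ge0 moS unitS sum1 posS).
Qed.
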